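(* Let $b$ be a geometric structure on a manifold $M$, and $\{\cdot,\cdot\}_{b,sym}$ the associated symmetric $b$-bracket. Then the following assertions hold: (i) $\{\cdot,\cdot\}_{b,sym}$ is a symmetric Leibniz bracket, and hence $(M,\{\cdot,\cdot\}_{b,sym})$ is a symmetric Leibniz manifold; (ii) for any fixed $F\in\mathcal{C}^{\infty}(M,\mathbb{R})$, the left and right Leibniz vector fields of $F$ associated to $\{\cdot,\cdot\}_{b,sym}$ coincide, and are both equal to $\dfrac{1}{2}\left(\nabla_{b}^{L}F+\nabla_{b}^{R}F\right)$.
   Context: All manifolds are connected, Hausdorff, paracompact and smooth; all maps are smooth. A geometric structure on a manifold $M$ is a non-degenerate $(0,2)$-tensor field $b:\mathfrak{X}(M)\times\mathfrak{X}(M)\to\mathcal{C}^{\infty}(M,\mathbb{R})$ (no symmetry is assumed). For $F\in\mathcal{C}^{\infty}(M,\mathbb{R})$, the left-gradient $\nabla^{L}_{b}F$ and the right-gradient $\nabla^{R}_{b}F$ are the vector fields uniquely defined by $b(\nabla^{L}_{b}F,X)=\mathrm{d}F\cdot X$ and $b(X,\nabla^{R}_{b}F)=\mathrm{d}F\cdot X$ for all $X\in\mathfrak{X}(M)$. The $b$-bracket is $\{F,G\}_b:=b(\nabla_{b}^{L}F,\nabla_{b}^{L}G)=b(\nabla_{b}^{R}F,\nabla_{b}^{R}G)$ (the two expressions agree), and the symmetric $b$-bracket is $\{F,G\}_{b,sym}:=\frac{1}{2}\left(\{F,G\}_{b}+\{G,F\}_{b}\right)$. A Leibniz bracket on $\mathcal{C}^{\infty}(M,\mathbb{R})$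 is an $\mathbb{R}$-bilinear map $\mathcal{C}^{\infty}(M,\mathbb{R})\times\mathcal{C}^{\infty}(M,\mathbb{R})\to\mathcal{C}^{\infty}(M,\mathbb{R})$ which is a derivation in each entry; a (symmetric) Leibniz manifold is a manifold together with a (symmetric) Leibniz bracket. For a Leibniz bracket $\{\cdot,\cdot\}$, the left-Leibniz vector field of $F$ is the derivation $G\mapsto\{G,F\}$ and the right-Leibniz vector field of $F$ is the derivation $G\mapsto\{F,G\}$, where vector fields are identified with derivations via $X(G)=\mathrm{d}G\cdot X$. *)

(* Defs.v *)
From HB Require Import structures.
From mathcomp Require Import all_boot all_order all_algebra.
From mathcomp Require Import sesquilinear.
From mathcomp Require Import mathcomp_extra boolp classical_sets functions.
From mathcomp Require Import cardinality reals interval_inference topology normedtype landau derive.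

Set Implicit Arguments.
Unset Strict Implicit.
Unset Printing Implicit Defensive.
Import Order.TTheory GRing.Theory Num.Theory.
Import numFieldNormedType.Exports.

Local Open Scope classical_set_scope.
Local Open Scope ring_scope.

Section Smooth.
Variables (R : realType) (V W : normedModType R).
Implicit Types (U : set V) (f g : V -> W).

(* For U open in a finite-dimensional V this is C^k on U: the derivatives
   'D_v f are required of class C^(k-1) for all directions v. *)
Fixpoint Cn (k : nat) U f : Prop :=
  match k with
  | 0 => forall x, U x -> {for x, continuous f}
  | k'.+1 => (forall x, U x -> differentiable f x) /\
             (forall v, Cn k' U ('D_v f))
  end.

Definition smooth_on U f := forall k, Cn k U f.

Lemma near_eq_differentiable f g x :
  (\near x, f x = g x) -> differentiable f x -> differentiable g x.
Proof.
move=> fg /diff_locallyP[dfc dfx].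
have fgx : f x = g x := nbhs_singleton fg.
have H : g \o shift x = cst (g x) + 'd f x +o_ 0 id.
  apply/eqaddoP => _/posnumP[e].
  have /eqaddoP /(_ e%:num (gt0 e)) := dfx.
  have fg0 : \forall h \near 0, f (h + x) = g (h + x).
    by move: fg; rewrite (near_shift 0) subr0.
  apply: filterS2 fg0 => h /= fgh.
  by rewrite !fctE /= -fgh -fgx.
have dE : 'd g x = 'd f x :> (V -> W) by apply: diff_unique.
by apply/diff_locallyP; rewrite dE.
Qed.

Lemma near_open U (P : V -> Prop) x : open U -> (forall y, U y -> P y) -> U x ->
  \near x, P x.
Proof. by move=> oU UP Ux; apply: filterS UP _; exact: open_nbhs_nbhs. Qed.

Lemma Cn_eq k U f g : open U -> (forall x, U x -> f x = g x) ->
  Cn k U f -> Cn k U g.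
Proof.
move=> oU; elim: k f g => [|k IH] f g fg /=.
  move=> cf x Ux; have nfg := near_open oU fg Ux.
  rewrite /prop_for /continuous_at -(fg _ Ux).
  exact: cvg_trans (near_eq_cvg nfg) (cf _ Ux).
move=> [df Df]; split=> [x Ux|v].
  exact: near_eq_differentiable (near_open oU fg Ux) (df _ Ux).
apply: IH (Df v) => x Ux.
by apply: near_eq_derive; exact: near_open oU fg Ux.
Qed.

Lemma Cn_cst k U (a : W) : Cn k U (cst a).
Proof.
elim: k a => [|k IH] a /=; first by move=> x _; exact: cst_continuous.
split=> [x _|v]; first exact: differentiable_cst.
have -> : 'D_v (cst a) = cst 0 by apply/funext => x; rewrite derive_cst.
exact: IH.
Qed.

Lemma CnD k U f g : open U -> Cn k U f -> Cn k U g -> Cn k U (f + g).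
Proof.
move=> oU; elim: k f g => [|k IH] f g /=.
  by move=> cf cg x Ux; apply: continuousD; [exact: cf|exact: cg].
move=> [df Df] [dg Dg]; split=> [x Ux|v].
  by apply: differentiableD; [exact: df|exact: dg].
apply: Cn_eq (IH _ _ (Df v) (Dg v)) => // x Ux.
by rewrite deriveD//; apply/diff_derivable; [exact: df|exact: dg].
Qed.

Lemma CnZ k U (a : R) f : open U -> Cn k U f -> Cn k U (a *: f).
Proof.
move=> oU; elim: k f => [|k IH] f /=.
  by move=> cf x Ux; apply: cvgZ; [exact: cvg_cst|exact: cf].
move=> [df Df]; split=> [x Ux|v].
  by apply: differentiableZ; exact: df.
apply: Cn_eq (IH _ (Df v)) => // x Ux.
by rewrite deriveZ//; apply/diff_derivable; exact: df.
Qed.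

Lemma CnW k U f : Cn k.+1 U f -> Cn k U f.
Proof.
elim: k f => [|k IH] f [df Df].
  by move=> x Ux; exact/differentiable_continuous/df.
by split=> // v; exact: IH.
Qed.

End Smooth.

Lemma CnM (R : realType) (V : normedModType R) k (U : set V) (f g : V -> R^o) :
  open U -> Cn k U f -> Cn k U g -> Cn k U (f * g).
Proof.
move=> oU; elim: k f g => [|k IH] f g.
  by move=> cf cg x Ux; apply: continuousM; [exact: cf|exact: cg].
move=> Cf Cg; have [df Df] := Cf; have [dg Dg] := Cg.
split=> [x Ux|v]; first by apply: differentiableM; [exact: df|exact: dg].
apply: Cn_eq (CnD oU (IH _ _ (CnW Cf) (Dg v)) (IH _ _ (CnW Cg) (Df v))) => //.
by move=> x Ux; rewrite deriveM//; apply/diff_derivable; [exact: df|exact: dg].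
Qed.

Definition locally_finite (T : topologicalType) (D : set (set T)) :=
  forall x : T, exists2 N, nbhs x N & finite_set [set A | D A /\ A `&` N !=set0].

Definition paracompact (T : topologicalType) :=
  forall C : set (set T), (forall A, C A -> open A) ->
    \bigcup_(A in C) A = [set: T] ->
  exists D : set (set T), [/\ forall A, D A -> open A,
    \bigcup_(A in D) A = [set: T],
    (forall A, D A -> exists2 B, C B & A `<=` B) &
    locally_finite D].

(* The charts of a smooth atlas, indexed by an arbitrary type: the chart c is
   the homeomorphism coord c from dom c onto an open subset of R^n, with inverse
   param c; the values of coord c and param c elsewhere are irrelevant. *)
Record manifold (R : realType) (n : nat) := Manifold {
  carrier :> topologicalType;
  chart : Type;
  dom : chart -> set carrier;
  coord : chart -> carrier -> 'rV[R]_n;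
  param : chart -> 'rV[R]_n -> carrier;
  dom_open : forall c, open (dom c);
  codom_open : forall c, open (coord c @` dom c);
  coordK : forall c p, dom c p -> param c (coord c p) = p;
  coord_continuous : forall c p, dom c p -> {for p, continuous (coord c)};
  param_continuous : forall c x, (coord c @` dom c) x ->
    {for x, continuous (param c)};
  dom_cover : forall p, exists c, dom c p;
  transition_smooth : forall c c',
    smooth_on (coord c @` (dom c `&` dom c')) (coord c' \o param c);
  manifold_hausdorff : hausdorff_space carrier;
  manifold_paracompact : paracompact carrier;
  manifold_connected : connected [set: carrier] }.

Section Manifold.
Variables (R : realType) (n : nat) (M : manifold R n).
Implicit Types (c : chart M) (p : M) (U : set M).

Definition chart_at p : chart M := projT1 (cid (dom_cover p)).

Definition smooth_fun_on U (F : M -> R^o) :=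
  forall c, smooth_on (coord c @` (U `&` dom c)) (F \o param c).

Definition Cinf_pred : {pred M -> R^o} := fun F => `[< smooth_fun_on setT F >].

Lemma Cinf_predP (F : M -> R^o) :
  reflect (forall c, smooth_on (coord c @` dom c) (F \o param c))
          (F \in Cinf_pred).
Proof. by apply: (iffP (asboolP _)) => + c => /(_ c); rewrite setTI. Qed.

Fact Cinf_submod_closed : submod_closed Cinf_pred.
Proof.
split=> [|a F G /Cinf_predP sF /Cinf_predP sG]; apply/Cinf_predP => c k.
  exact: (@Cn_cst _ _ R^o k _ 0).
apply: CnD; [exact: codom_open| |exact: sG].
by apply: CnZ; [exact: codom_open|exact: sF].
Qed.

Fact Cinf_subring_closed : subring_closed Cinf_pred.
Proof.
have [Cinf0 CinfZD] := Cinf_submod_closed.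
split=> [|F G sF sG|F G /Cinf_predP sF /Cinf_predP sG].
- by apply/Cinf_predP => c k; exact: (@Cn_cst _ _ R^o k _ 1).
- by rewrite addrC -scaleN1r CinfZD.
- by apply/Cinf_predP => c k; apply: CnM; [exact: codom_open|exact: sF|exact: sG].
Qed.

HB.instance Definition _ :=
  GRing.isSubringClosed.Build (M -> R^o) Cinf_pred Cinf_subring_closed.
HB.instance Definition _ :=
  GRing.isSubmodClosed.Build R (M -> R^o) Cinf_pred Cinf_submod_closed.

Record Cinf := MkCinf { Cinf_fun :> M -> R^o; _ : Cinf_fun \in Cinf_pred }.

HB.instance Definition _ := [isSub for Cinf_fun].
HB.instance Definition _ := [Choice of Cinf by <:].
HB.instance Definition _ := GRing.SubChoice_isSubComPzRing.Build _ _ Cinf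
  (GRing.subringClosedP _).
HB.instance Definition _ := [SubZmodule_isSubLmodule of Cinf by <:].

(* A tangent vector at p is given by its coordinates in all the charts around p,
   related by the differentials of the transition maps; its coordinates in the
   other charts are set to 0 so that equality of tangent vectors is _ = _. *)
Definition tangent_pred p : {pred chart M -> 'rV[R]_n} := fun v =>
  `[< (forall c, ~ dom c p -> v c = 0) /\
      (forall c c', dom c p -> dom c' p ->
         v c' = 'd (coord c' \o param c) (coord c p) (v c)) >].

Fact tangent_submod_closed p : submod_closed (tangent_pred p).
Proof.
split=> [|a u v /asboolP[u0 uE] /asboolP[v0 vE]]; apply/asboolP; split.
- by [].
- by move=> c c' _ _; rewrite linear0.
- by move=> c cp; rewrite -[LHS]/(a *: u c + v c) u0// v0// addr0 scaler0.
- move=> c c' cp cp'; rewrite -[LHS]/(a *: u c' + v c').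
  by rewrite -[X in 'd _ _ X]/(a *: u c + v c) linearP -(uE c)// -(vE c).
Qed.

HB.instance Definition _ p :=
  GRing.isSubmodClosed.Build R _ (tangent_pred p) (tangent_submod_closed p).

Record tangent p := MkTangent {
  components :> chart M -> 'rV[R]_n; _ : components \in tangent_pred p }.

HB.instance Definition _ p := [isSub for @components p].
HB.instance Definition _ p := [Choice of tangent p by <:].
HB.instance Definition _ p := [SubChoice_isSubZmodule of tangent p by <:].
HB.instance Definition _ p := [SubZmodule_isSubLmodule of tangent p by <:].

(* dF_p(v); the value does not depend on the chart around p. *)
Definition dF (F : M -> R^o) p (v : tangent p) : R :=
  'd (F \o param (chart_at p)) (coord (chart_at p) p) (v (chart_at p)).

Definition section := forall p, tangent p.

HB.instance Definition _ := Choice.on section.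

Let addA : associative (fun (X Y : section) p => X p + Y p).
Proof. by move=> X Y Z; apply: functional_extensionality_dep => p; rewrite addrA. Qed.
Let addC : commutative (fun (X Y : section) p => X p + Y p).
Proof. by move=> X Y; apply: functional_extensionality_dep => p; rewrite addrC. Qed.
Let add0 : left_id (fun p => 0 : tangent p) (fun (X Y : section) p => X p + Y p).
Proof. by move=> X; apply: functional_extensionality_dep => p; rewrite add0r. Qed.
Let addN : left_inverse (fun p => 0 : tangent p) (fun (X : section) p => - X p)
  (fun (X Y : section) p => X p + Y p).
Proof. by move=> X; apply: functional_extensionality_dep => p; rewrite addNr. Qed.

HB.instance Definition _ := GRing.isZmodule.Build section addA addC add0 addN.

Let scaleA (a b : R) (X : section) :
  (fun p => a *: (b *: X p)) = (fun p => (a * b) *: X p).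
Proof. by apply: functional_extensionality_dep => p; rewrite scalerA. Qed.
Let scale1 : left_id 1 (fun (a : R) (X : section) p => a *: X p).
Proof. by move=> X; apply: functional_extensionality_dep => p; rewrite scale1r. Qed.
Let scaleDr : right_distributive (fun (a : R) (X : section) p => a *: X p) +%R.
Proof. by move=> a X Y; apply: functional_extensionality_dep => p; exact: scalerDr. Qed.
Let scaleDl (X : section) :
  {morph (fun (a : R) => (fun p => a *: X p) : section) : a b / a + b}.
Proof. by move=> a b; apply: functional_extensionality_dep => p; exact: scalerDl. Qed.

HB.instance Definition _ :=
  GRing.Zmodule_isLmodule.Build R section scaleA scale1 scaleDr scaleDl.

Definition smooth_section_on U (X : section) :=
  forall c, smooth_on (coord c @` (U `&` dom c)) (fun x => X (param c x) c).

Definition vector_field_pred : {pred section} :=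
  fun X => `[< smooth_section_on setT X >].

Fact vector_field_submod_closed : submod_closed vector_field_pred.
Proof.
split=> [|a X Y /asboolP sX /asboolP sY]; apply/asboolP => c k.
  exact: (@Cn_cst _ _ 'rV[R]_n k _ 0).
have oc : open (coord c @` (setT `&` dom c)) by rewrite setTI; exact: codom_open.
by apply: CnD; [|apply: CnZ => //; exact: sX|exact: sY].
Qed.

HB.instance Definition _ := GRing.isSubmodClosed.Build R section
  vector_field_pred vector_field_submod_closed.

Record vector_field := MkVectorField {
  vector_field_section : section;
  _ : vector_field_section \in vector_field_pred }.

HB.instance Definition _ := [isSub for vector_field_section].
HB.instance Definition _ := [Choice of vector_field by <:].
HB.instance Definition _ := [SubChoice_isSubZmodule of vector_field by <:].
HB.instance Definition _ := [SubZmodule_isSubLmodule of vector_field by <:].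

Definition vector_at (X : vector_field) p : tangent p :=
  vector_field_section X p.
Coercion vector_at : vector_field >-> Funclass.

(* The derivation identified with X, i.e. G |-> dG . X. *)
Definition derivation_of (X : vector_field) (G : Cinf) : M -> R^o :=
  fun p => dF G (X p).

(* A smooth family of bilinear forms b_p on the tangent spaces. Smoothness is
   that of a tensor field: b maps smooth sections over an open set U to smooth
   functions on U; for U = M this is the map on global vector fields. Since the
   tangent spaces are finite-dimensional, the two non-degeneracy conditions are
   equivalent to each other. *)
Record geometric_structure := GeometricStructure {
  form : forall p, {bilinear tangent p -> tangent p -> R^o};
  form_smooth : forall U (X Y : section), open U ->
    smooth_section_on U X -> smooth_section_on U Y ->
    smooth_fun_on U (fun p => form p (X p) (Y p));
  form_nondegl : forall p (v : tangent p), (forall w, form p v w = 0) -> v = 0;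
  form_nondegr : forall p (w : tangent p), (forall v, form p v w = 0) -> w = 0 }.

Variable b : geometric_structure.

Fact apply_form_smooth (X Y : vector_field) :
  (fun p => form b p (X p) (Y p)) \in Cinf_pred.
Proof.
apply/asboolP; apply: form_smooth; first exact: openT.
- exact/asboolP/(valP X).
- exact/asboolP/(valP Y).
Qed.

Definition apply_form (X Y : vector_field) : Cinf :=
  MkCinf (apply_form_smooth X Y).

(* Non-degeneracy makes the gradients exist and be unique, so that the default
   value 0 of xget plays no role. *)
Definition left_gradient (F : Cinf) : vector_field :=
  xget 0 [set X | forall Y, apply_form X Y = derivation_of Y F :> (M -> R^o)].

Definition right_gradient (F : Cinf) : vector_field :=
  xget 0 [set X | forall Y, apply_form Y X = derivation_of Y F :> (M -> R^o)].

(* This is also apply_form (right_gradient F) (right_gradient G). *)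
Definition b_bracket (F G : Cinf) : Cinf :=
  apply_form (left_gradient F) (left_gradient G).

Definition sym_b_bracket (F G : Cinf) : Cinf :=
  2^-1 *: (b_bracket F G + b_bracket G F).

Definition leibniz_rule (D : Cinf -> Cinf) :=
  forall F G, D (F * G) = D F * G + F * D G.

Definition leibniz_bracket (br : Cinf -> Cinf -> Cinf) :=
  [/\ bilinear_for *:%R *:%R br,
      forall F, leibniz_rule (br F) &
      forall G, leibniz_rule (br^~ G)].

Definition symmetric_leibniz_bracket (br : Cinf -> Cinf -> Cinf) :=
  leibniz_bracket br /\ forall F G, br F G = br G F.

(* Vector fields being identified with derivations, the Leibniz vector fields of
   F are given here as operators on functions; see derivation_of. *)
Definition left_leibniz_vf (br : Cinf -> Cinf -> Cinf) (F : Cinf) :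
  Cinf -> Cinf := fun G => br G F.

Definition right_leibniz_vf (br : Cinf -> Cinf -> Cinf) (F : Cinf) :
  Cinf -> Cinf := fun G => br F G.

End Manifold.

(* The pair (M, br) is a symmetric Leibniz manifold. *)
Definition symmetric_leibniz_manifold (R : realType) (n : nat)
    (M : manifold R n) (br : Cinf M -> Cinf M -> Cinf M) :=
  symmetric_leibniz_bracket br.

(* Main.v *)
From HB Require Import structures.
From mathcomp Require Import all_boot all_order all_algebra.
From mathcomp Require Import sesquilinear.
From mathcomp Require Import boolp classical_sets functions reals.
From mathcomp Require Import topology normedtype landau derive.
Require Import Defs.

(** Once the gradients are known to exist as smooth vector fields, the
    proposition is a short computation.  Writing L_F and R_F for the left and
    right gradients of F, the definition of L_F applied to the field L_G gives
    {F, G} = b(L_F, L_G) = dF(L_G), and the definitions of R_F and L_G give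
    dF(L_G) = b(L_G, R_F) = dG(R_F).  Averaging {F, G} = dG(R_F) with
    {G, F} = dG(L_F) yields {F, G}_sym = dG((L_F + R_F) / 2)
    ([sym_b_bracketE]).  This is assertion (ii), and it shows that the symmetric
    bracket is linear and a derivation in G; symmetry transfers both properties
    to F.

    The substance is therefore the existence of gradients ([gradient_exists]).
    In a chart c the coordinate frame E_1, ..., E_n turns the form b into its
    Gram matrix B = (b(E_i, E_j)), and a vector field with coordinate row u is
    the left gradient of F exactly when u B = (dF(E_1), ..., dF(E_n)).  At each
    point B is invertible by non-degeneracy, which gives the gradient pointwise.
    Its smoothness is Cramer's rule: the solution u of a linear system u A = r
    with smooth entries and invertible A is smooth ([Cn_solve]).  The right
    gradient is the left gradient for the transposed form.

    The entries of B are smooth because b maps smooth local sections to smooth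
    functions, so the frame E_j has to be a smooth section in every chart c',
    not only in c ([coord_frame_smooth]).  There too [Cn_solve] applies: the
    coordinates of E_j in c' solve the linear system given by the Jacobian
    matrix of the transition map from c' to c, so that the chain rule is only
    used to first order. *)

Set Implicit Arguments.
Unset Strict Implicit.
Unset Printing Implicit Defensive.
Import Order.TTheory GRing.Theory Num.Theory.
Import numFieldNormedType.Exports.
Local Open Scope classical_set_scope.
Local Open Scope ring_scope.

(** * Functions of class C^k: stability under algebraic operations *)

Section Calculus.
Variables (R : realType) (V : normedModType R).
Implicit Types (U : set V) (k : nat).

Lemma Cn_comp_linear (W W' : normedModType R) k U (L : {linear W -> W'})
    (f : V -> W) :
  open U -> continuous L -> Cn k U f -> Cn k U (L \o f).
Proof.
move=> oU cL; elim: k f => [|k IH] f /=.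
  by move=> cf x Ux; apply: continuous_comp; [exact: cf|exact: cL].
move=> [df Df]; split=> [x Ux|v].
  by apply: differentiable_comp; [exact: df|exact: linear_differentiable].
apply: Cn_eq (IH _ (Df v)) => // x Ux.
have dL : differentiable L (f x) by exact: linear_differentiable.
rewrite [RHS]deriveE; last by apply: differentiable_comp => //; exact: df.
by rewrite diff_comp ?diff_lin//=; [rewrite deriveE//; exact: df|exact: df].
Qed.

Lemma Cn_sum (W : normedModType R) k U (I : Type) (r : seq I) (P : pred I)
    (f : I -> V -> W) :
  open U -> (forall i, Cn k U (f i)) ->
  Cn k U (fun x => \sum_(i <- r | P i) f i x).
Proof.
move=> oU Cf; rewrite -fct_sumE.
elim/big_rec: _ => [|i g _ Cg]; first exact: (@Cn_cst _ _ _ k U 0).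
exact: CnD.
Qed.

Lemma Cn_prod k U (I : Type) (r : seq I) (P : pred I) (f : I -> V -> R^o) :
  open U -> (forall i, Cn k U (f i)) ->
  Cn k U ((fun x => \prod_(i <- r | P i) f i x) : V -> R^o).
Proof.
move=> oU Cf; rewrite -fct_prodE.
elim/big_rec: _ => [|i g _ Cg]; first exact: (@Cn_cst _ _ R^o k U 1).
exact: CnM.
Qed.

(** The derivative of 1/f is - (1/f)^2 f', a product of functions already of
    class C^k by the induction hypothesis on 1/f itself. *)
Lemma CnV k U (f : V -> R^o) :
  open U -> (forall x, U x -> f x != 0) -> Cn k U f ->
  Cn k U ((fun x => (f x)^-1) : V -> R^o).
Proof.
move=> oU f0; elim: k => [|k IH] Cf.
  by move=> x Ux; apply: cvgV; [exact: f0|exact: Cf].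
have [df Df] := Cf; have Cfi := IH (CnW Cf).
split=> [x Ux|v]; first by apply: differentiableV; [exact: df|exact: f0].
apply: (Cn_eq oU _ (CnZ (-1) oU (CnM oU (CnM oU Cfi Cfi) (Df v)))) => x Ux.
rewrite deriveV; [|exact: f0|by apply/diff_derivable; exact: df].
by rewrite !fctE expr2 invfM scaleN1r scaleNr.
Qed.

(** Coordinates are continuous linear maps, and conversely f is the sum of its
    coordinates carried into 'rV by the linear maps t |-> t *: e_j; both
    directions are thus instances of composition with a linear map. *)
Lemma Cn_rVP k U n (f : V -> 'rV[R]_n) : open U ->
  Cn k U f <-> forall j, Cn k U ((fun x => f x 0 j) : V -> R^o).
Proof.
move=> oU; split=> [Cf j|Cf].
  have lin : linear ((fun a : 'rV[R]_n => a 0 j) : 'rV[R]_n -> R^o).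
    by move=> a u v; rewrite !mxE.
  pose L : {linear 'rV[R]_n -> R^o} :=
    HB.pack (fun a : 'rV[R]_n => a 0 j) (GRing.isLinear.Build _ _ _ _ _ lin).
  apply: (@Cn_comp_linear _ _ _ _ L) Cf => //.
  exact: matrix_normedtype.coord_continuous.
have -> : f = fun x => \sum_j f x 0 j *: delta_mx 0 j.
  by apply/funext => x; rewrite -row_sum_delta.
apply: Cn_sum => // j.
have lin : linear ((fun t => t *: delta_mx 0 j) : R^o -> 'rV[R]_n).
  by move=> a u v; rewrite scalerDl -scalerA.
pose L : {linear R^o -> 'rV[R]_n} :=
  HB.pack (fun t : R => t *: (delta_mx 0 j : 'rV[R]_n))
    (GRing.isLinear.Build _ _ _ _ _ lin).
by apply: (@Cn_comp_linear _ _ _ _ L) (Cf j) => //; exact: scalel_continuous.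
Qed.

Lemma Cn_det k U n (A : V -> 'M[R]_n) :
  open U -> (forall i j, Cn k U ((fun x => A x i j) : V -> R^o)) ->
  Cn k U ((fun x => \det (A x)) : V -> R^o).
Proof.
move=> oU CA; apply: Cn_sum => // s.
by apply: CnM; [|exact: Cn_cst|exact: Cn_prod].
Qed.

(** Cramer's rule expresses u through the cofactors of A, the inverse of its
    determinant and r.  Its role is to give smoothness to vectors that are only
    known by the linear equations they satisfy. *)
Lemma Cn_solve k U n (A : V -> 'M[R]_n) (u r : V -> 'rV[R]_n) :
  open U -> (forall i j, Cn k U ((fun x => A x i j) : V -> R^o)) ->
  Cn k U r -> (forall x, U x -> A x \in unitmx) ->
  (forall x, U x -> u x *m A x = r x) -> Cn k U u.
Proof.
move=> oU CA /(Cn_rVP _ _ oU) Cr Au uA; apply/Cn_rVP => // j.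
pose h x : R^o := \sum_i r x 0 i * ((\det (A x))^-1 * cofactor (A x) j i).
apply: (@Cn_eq _ _ _ _ _ h) => // [x Ux|].
  rewrite -[u x](mulmxK (Au x Ux)) uA// mxE; apply: eq_bigr => i _.
  by rewrite /invmx Au// !mxE.
apply: Cn_sum => // i; apply: CnM => //; apply: CnM => //.
  by apply: CnV; [|move=> x /Au; rewrite unitmxE unitfE|exact: Cn_det].
apply: CnM => //; first exact: Cn_cst.
by apply: Cn_det => // i' j'; under eq_fun do rewrite !mxE; exact: CA.
Qed.

Lemma near_eq_diff (W : normedModType R) (f g : V -> W) x v :
  (\near x, f x = g x) -> differentiable f x -> 'd f x v = 'd g x v.
Proof.
move=> fg df; rewrite -!deriveE//; first exact: near_eq_derive.
exact: near_eq_differentiable fg df.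
Qed.

End Calculus.

(** * Charts, tangent vectors and coordinate frames *)

Section Charts.
Variables (R : realType) (n : nat) (M : manifold R n).
Implicit Types (c : chart M) (p : M) (U : set M).

(** For U the whole manifold this says that chart images are neighborhoods,
    which is what lets an identity valid on a chart be differentiated. *)
Lemma near_param c p U : open U -> U p -> dom c p ->
  \forall x \near coord c p, (coord c @` (U `&` dom c)) x.
Proof.
move=> oU Up cp; have im_cp : (coord c @` dom c) (coord c p) by exists p.
have near_im : \forall x \near coord c p, (coord c @` dom c) x.
  by apply: open_nbhs_nbhs; split=> //; exact: codom_open.
have near_U : \forall x \near coord c p, U (param c x).
  apply: (param_continuous im_cp); rewrite coordK//.
  exact: open_nbhs_nbhs.
apply: filterS2 near_im near_U => _ [q cq <-]; rewrite coordK// => Uq.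
by exists q.
Qed.

Lemma open_coord_image c U : open U -> open (coord c @` (U `&` dom c)).
Proof. by move=> oU; rewrite openE => _ [p [Up cp] <-]; exact: near_param. Qed.

Lemma transition_diff c c' p : dom c p -> dom c' p ->
  differentiable (coord c' \o param c) (coord c p).
Proof.
move=> cp cp'; have [+ _] := transition_smooth c c' 1.
by apply; exists p.
Qed.

(** The chain rule for F \o param c = (F \o param c') \o (coord c' \o param c),
    an equality valid only near coord c p.  For F a function it makes dF
    independent of the chart; for F another coordinate map it is the cocycle
    identity of the differentials of transition maps. *)
Lemma diff_param_change (W : normedModType R) (F : M -> W) c c' p v :
  dom c p -> dom c' p -> differentiable (F \o param c') (coord c' p) ->
  'd (F \o param c) (coord c p) v =
  'd (F \o param c') (coord c' p) ('d (coord c' \o param c) (coord c p) v).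
Proof.
move=> cp cp' dF; have dt := transition_diff cp cp'.
set t := coord c' \o param c in dt *; set G := F \o param c' in dF *.
have tcp : t (coord c p) = coord c' p by rewrite /t /= coordK.
rewrite -tcp in dF *.
have GtE : \forall x \near coord c p, (G \o t) x = (F \o param c) x.
  apply: filterS (near_param (dom_open c') cp' cp) => _ [q [cq' cq] <-].
  by rewrite /G /t /= !coordK.
rewrite -[LHS](near_eq_diff v GtE (differentiable_comp dt dF)).
exact: (congr1 (fun h => h v) (diff_comp dt dF)).
Qed.

Lemma diff_transition_id c p v : dom c p ->
  'd (coord c \o param c) (coord c p) v = v.
Proof.
move=> cp.
have idE : \forall x \near coord c p, id x = (coord c \o param c) x.
  apply: filterS (near_param openT I cp) => _ [q [_ cq] <-] /=.
  by rewrite coordK.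
rewrite -[LHS](near_eq_diff v idE); last exact: ex_diff.
by rewrite (@diff_lin _ _ _ idfun) => [|x]; [|exact: cvg_id].
Qed.

(** Outside of dom c the value 0 makes this a tangent vector at every p, so that
    coordinate frames are sections defined on all of M. *)
Definition coord_components c p (v : 'rV[R]_n) : chart M -> 'rV[R]_n :=
  fun c' => if `[< dom c p /\ dom c' p >]
            then 'd (coord c' \o param c) (coord c p) v else 0.

Fact coord_components_tangent c p v : coord_components c p v \in tangent_pred p.
Proof.
apply/asboolP; split=> [c' ncp'|c' c'' cp' cp''].
  by rewrite /coord_components asboolF// => -[].
have [cp|ncp] := pselect (dom c p); last first.
  by rewrite /coord_components !asboolF ?linear0// => -[].
rewrite /coord_components !asboolT//.
by apply: diff_param_change => //; exact: transition_diff.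
Qed.

Definition coord_tangent c p v : tangent p :=
  MkTangent (coord_components_tangent c p v).

Lemma coord_tangentE c c' p v : dom c p -> dom c' p ->
  coord_tangent c p v c' = 'd (coord c' \o param c) (coord c p) v.
Proof. by move=> cp cp'; rewrite /= /coord_components asboolT. Qed.

Lemma coord_tangentK c p v : dom c p -> coord_tangent c p v c = v.
Proof. by move=> cp; rewrite coord_tangentE// diff_transition_id. Qed.

Lemma tangent_change c c' p (v : tangent p) : dom c p -> dom c' p ->
  v c' = 'd (coord c' \o param c) (coord c p) (v c).
Proof. by case: v => v /asboolP[_ vE] /=; exact: vE. Qed.

(** The transition differentials determine the components in all the charts
    around p from those in one of them. *)
Lemma tangent_inj c p (v w : tangent p) : dom c p -> v c = w c -> v = w.
Proof.
move=> cp vw; apply: val_inj; apply/funext => c' /=.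
have [cp'|ncp'] := pselect (dom c' p).
  by rewrite (tangent_change v cp cp') (tangent_change w cp cp') vw.
by case: v w {vw} => v /asboolP[v0 _] [w /asboolP[w0 _]] /=; rewrite v0// w0.
Qed.

Lemma components_linear c p (a : R) (u v : tangent p) :
  (a *: u + v) c = a *: u c + v c.
Proof. by []. Qed.

Lemma coord_tangent_expand c p (v : tangent p) : dom c p ->
  v = \sum_j v c 0 j *: coord_tangent c p (delta_mx 0 j).
Proof.
move=> cp; apply: (tangent_inj cp).
have sumE (I : Type) (r : seq I) (f : I -> tangent p) :
    (\sum_(i <- r) f i) c = \sum_(i <- r) f i c.
  by elim/big_rec2: _ => // i x y _ <-.
rewrite sumE [LHS]row_sum_delta; apply: eq_bigr => j _.
by rewrite -[RHS]/(_ *: coord_tangent c p _ c) coord_tangentK.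
Qed.

Definition coord_frame c (j : 'I_n) : section M :=
  fun p => coord_tangent c p (delta_mx 0 j).

Lemma row_solve_unitmx (m : nat) (A : 'M[R]_m) :
  (forall v : 'rV[R]_m, exists u, u *m A = v) -> A \in unitmx.
Proof.
move=> solA; rewrite -row_full_unit -sub1mx; apply/row_subP => i.
by have [u <-] := solA (row i 1%:M); exact: submxMl.
Qed.

Lemma row_mul_jacobian (f : 'rV[R]_n -> 'rV[R]_n) x v : differentiable f x ->
  v *m jacobian f x = 'd f x v.
Proof. by move=> df; rewrite -deriveEjacobian// deriveE. Qed.

(** In another chart c', the components u of the frame vector satisfy
    u *m J = e_j, where J is the Jacobian matrix of the transition map from c'
    to c.  The entries of J are partial derivatives of a smooth map, and J is
    invertible because the two transition maps are inverse to each other. *)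
Lemma coord_frame_smooth c j : smooth_section_on (dom c) (coord_frame c j).
Proof.
move=> c' k; set U := coord c' @` _.
have oU : open U by apply: open_coord_image; exact: dom_open.
have inverse q v : dom c q -> dom c' q ->
    'd (coord c' \o param c) (coord c q) v
      *m jacobian (coord c \o param c') (coord c' q) = v.
  move=> cq cq'; rewrite row_mul_jacobian; last exact: transition_diff.
  rewrite -diff_param_change ?diff_transition_id//.
  exact: transition_diff.
have trans_smooth : smooth_on U (coord c \o param c').
  by rewrite /U setIC; exact: transition_smooth.
apply: (Cn_solve oU (A := jacobian (coord c \o param c'))
  (r := cst (delta_mx 0 j))).
- move=> i l; have [dt Dt] := trans_smooth k.+1.
  apply: (Cn_eq oU _ ((Cn_rVP _ _ oU).1 (Dt (delta_mx 0 i)) l)) => x Ux.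
  by rewrite deriveEjacobian -?rowE ?mxE//; exact: dt.
- exact: Cn_cst.
- move=> _ [q [cq cq'] <-]; apply: row_solve_unitmx => v.
  by eexists; exact: inverse.
- move=> _ [q [cq cq'] <-]; rewrite coordK//.
  by rewrite coord_tangentE// inverse.
Qed.

Lemma Cinf_ext (F G : Cinf M) : (forall p, F p = G p) -> F = G.
Proof. by move=> FG; apply: val_inj; apply/funext. Qed.

Lemma Cinf_smooth (F : Cinf M) c :
  smooth_on (coord c @` dom c) (F \o param c).
Proof. by have /Cinf_predP := valP F. Qed.

Lemma Cinf_diff (F : Cinf M) c p : dom c p ->
  differentiable (F \o param c) (coord c p).
Proof. by move=> cp; have [+ _] := Cinf_smooth F c 1; apply; exists p. Qed.

Lemma chart_at_dom p : dom (chart_at p) p.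
Proof. by rewrite /chart_at; case: cid. Qed.

Lemma dF_coord (F : Cinf M) c p (v : tangent p) : dom c p ->
  dF F v = 'd (F \o param c) (coord c p) (v c).
Proof.
move=> cp; have cp' := chart_at_dom p.
rewrite (tangent_change v cp' cp); apply: diff_param_change => //.
exact: Cinf_diff.
Qed.

Lemma dF_linear (F : Cinf M) p : linear (@dF _ _ M F p : tangent p -> R^o).
Proof. by move=> a u v; rewrite /dF components_linear linearP. Qed.

Lemma dF_linear_fun (a : R) (F G : Cinf M) p (v : tangent p) :
  dF (a *: F + G) v = a * dF F v + dF G v.
Proof.
have cp := chart_at_dom p.
have dF' := differentiableZ a (Cinf_diff F cp).
have dD := congr1 (@^~ (v (chart_at p))) (diffD dF' (Cinf_diff G cp)).
have dZ := congr1 (@^~ (v (chart_at p))) (diffZ a (Cinf_diff F cp)).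
exact: etrans dD (congr1 (+%R^~ _) dZ).
Qed.

Lemma dF_leibniz (F G : Cinf M) p (v : tangent p) :
  dF (F * G) v = dF F v * G p + F p * dF G v.
Proof.
have cp := chart_at_dom p.
have dM := congr1 (@^~ (v (chart_at p)))
  (diffM (Cinf_diff F cp) (Cinf_diff G cp)).
have FE (H : Cinf M) : (H \o param (chart_at p)) (coord (chart_at p) p) = H p.
  by rewrite /= coordK.
have key (f g f' g' x y : R) : f = f' -> g = g' ->
    f * x + g * y = y * g' + f' * x.
  by move=> -> ->; rewrite addrC [y * _]mulrC.
exact: etrans dM (key _ _ _ _ _ _ (FE F) (FE G)).
Qed.

Lemma coord_frame_ext c p (f g : tangent p -> R^o) : dom c p ->
  linear f -> linear g ->
  (forall j, f (coord_frame c j p) = g (coord_frame c j p)) -> f =1 g.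
Proof.
move=> cp lf lg fg v; rewrite (coord_tangent_expand v cp).
pose f' : {linear _ -> R^o} := HB.pack f (GRing.isLinear.Build _ _ _ _ _ lf).
pose g' : {linear _ -> R^o} := HB.pack g (GRing.isLinear.Build _ _ _ _ _ lg).
rewrite -[LHS]/(f' _) -[RHS]/(g' _) !linear_sum; apply: eq_bigr => j _.
by rewrite !linearZ -[f' _]/(f _) fg.
Qed.

End Charts.

(** * Existence of gradients *)

Section Gradient.
Variables (R : realType) (n : nat) (M : manifold R n).
Implicit Types (b : geometric_structure M) (c : chart M) (p : M) (F : Cinf M).

Definition gram b c p : 'M[R]_n :=
  \matrix_(i, j) form b p (coord_frame c i p) (coord_frame c j p).

Definition dF_row F c p : 'rV[R]_n := \row_j dF F (coord_frame c j p).

(** The row v c *m gram b c p represents the linear form b(v, _) in the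
    coordinate frame; hence v is the left gradient of F at p when this row is
    dF_row F c p. *)
Lemma form_frame b c p (v : tangent p) : dom c p ->
  v c *m gram b c p = \row_j form b p v (coord_frame c j p).
Proof.
move=> cp; apply/rowP => j; rewrite !mxE {2}(coord_tangent_expand v cp).
rewrite linear_sumlz; apply: eq_bigr => i _.
by rewrite mxE linearZl_LR.
Qed.

(** A row v in the left kernel of the Gram matrix is the coordinate row of a
    tangent vector u with b(u, E_j) = 0 for all j, hence with b(u, _) = 0. *)
Lemma gram_unitmx b c p : dom c p -> gram b c p \in unitmx.
Proof.
move=> cp; rewrite -row_free_unit; apply: inj_row_free => v vG.
rewrite -(coord_tangentK v cp).
rewrite (@form_nondegl _ _ _ b p (coord_tangent c p v))//.
apply: (@coord_frame_ext _ _ _ c p _ (fun=> 0)) => //; first exact: linearPr.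
  by move=> a u w; rewrite scaler0 addr0.
move=> j; have /rowP /(_ j) := form_frame b (coord_tangent c p v) cp.
by rewrite coord_tangentK// vG !mxE.
Qed.

Lemma pointwise_gradient b F p :
  exists v : tangent p, forall w, form b p v w = dF F w.
Proof.
pose c := chart_at p; have cp : dom c p := chart_at_dom p.
pose v := coord_tangent c p (dF_row F c p *m invmx (gram b c p)); exists v.
apply: (coord_frame_ext cp); [exact: linearPr|exact: dF_linear|move=> j].
have /rowP /(_ j) := form_frame b v cp.
by rewrite coord_tangentK// mulmxKV ?gram_unitmx// !mxE.
Qed.

Lemma gram_smooth b c i j :
  smooth_on (coord c @` dom c) ((fun x => gram b c (param c x) i j) : _ -> R^o).
Proof.
have := form_smooth b (dom_open c) (coord_frame_smooth c i)
    (coord_frame_smooth c j).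
move=> /(_ c); rewrite setIid => bs k.
by apply: Cn_eq (bs k) => [|x _]; [exact: codom_open|rewrite mxE].
Qed.

Lemma dF_row_smooth F c :
  smooth_on (coord c @` dom c) (fun x => dF_row F c (param c x)).
Proof.
move=> k; have oU := @codom_open _ _ M c; apply/Cn_rVP => // j.
have [_ DF] := @Cinf_smooth _ _ _ F c k.+1.
apply: (Cn_eq oU _ (DF (delta_mx 0 j))) => _ [p cp <-].
rewrite deriveE; last exact: Cinf_diff.
by rewrite mxE coordK// (dF_coord F _ cp) coord_tangentK.
Qed.

(** The gradient is chosen pointwise, and the linear system that it satisfies in
    each chart forces it to be smooth. *)
Lemma gradient_exists b F :
  exists X : vector_field M,
    forall p (w : tangent p), form b p (X p) w = dF F w.
Proof.
pose X : section M := fun p => projT1 (cid (pointwise_gradient b F p)).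
have Xg p w : form b p (X p) w = dF F w by rewrite /X; case: cid.
have sX : X \in @vector_field_pred R n M.
  apply/asboolP => c k; rewrite setTI.
  apply: (Cn_solve (@codom_open _ _ M c) (A := fun x => gram b c (param c x))
    (r := fun x => dF_row F c (param c x))).
  - by move=> i j; exact: gram_smooth.
  - exact: dF_row_smooth.
  - by move=> _ [p cp <-]; rewrite coordK// gram_unitmx.
  - move=> _ [p cp <-]; rewrite coordK// form_frame//.
    by apply/rowP => j; rewrite !mxE Xg.
by exists (MkVectorField sX).
Qed.

(** The transpose of b, under which right gradients become left gradients. *)
Definition flip_map b p (v w : tangent p) : R^o := form b p w v.

Fact flip_map_bilinear b p : bilinear_for *:%R *:%R (@flip_map b p).
Proof. by split=> u a v w; rewrite /flip_map (linearPr, linearPl). Qed.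

HB.instance Definition _ b p :=
  bilinear_isBilinear.Build R _ _ _ _ _ (@flip_map b p) (flip_map_bilinear b p).

Definition flip b : geometric_structure M :=
  @GeometricStructure R n M (fun p => @flip_map b p)
    (fun U X Y oU sX sY => form_smooth b oU sY sX)
    (@form_nondegr _ _ _ b) (@form_nondegl _ _ _ b).

Lemma left_gradientP b F (Y : vector_field M) p :
  form b p (left_gradient b F p) (Y p) = dF F (Y p).
Proof.
have [X Xg] := gradient_exists b F.
have XP : exists X,
    [set X | forall Y, apply_form b X Y = derivation_of Y F :> (M -> R^o)] X.
  by exists X => Z; apply/funext => q; exact: Xg.
exact: (congr1 (@^~ p) (xgetPex 0 XP Y)).
Qed.

Lemma right_gradientP b F (Y : vector_field M) p :
  form b p (Y p) (right_gradient b F p) = dF F (Y p).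
Proof.
have [X Xg] := gradient_exists (flip b) F.
have XP : exists X,
    [set X | forall Y, apply_form b Y X = derivation_of Y F :> (M -> R^o)] X.
  by exists X => Z; apply/funext => q; exact: Xg.
exact: (congr1 (@^~ p) (xgetPex 0 XP Y)).
Qed.

(** * The brackets as directional derivatives *)

Lemma b_bracket_left b F G p : b_bracket b F G p = dF F (left_gradient b G p).
Proof. exact: left_gradientP. Qed.

(** Test the definition of the right gradient of F on the left gradient of G. *)
Lemma b_bracket_right b F G p : b_bracket b F G p = dF G (right_gradient b F p).
Proof.
by rewrite b_bracket_left -(right_gradientP b F) left_gradientP.
Qed.

(** The bracket of F and G is read through the right gradient of F, and the
    bracket of G and F through the left gradient of F. *)
Lemma sym_b_bracketE b F G p : sym_b_bracket b F G p =
  dF G ((2^-1 *: (left_gradient b F + right_gradient b F) : vector_field M) p).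
Proof.
pose L : {linear tangent p -> R^o} :=
  HB.pack (@dF _ _ M G p)
    (GRing.isLinear.Build _ _ _ _ _ (@dF_linear _ _ _ G p)).
have LE (u v : tangent p) : dF G (2^-1 *: (u + v)) = 2^-1 * (dF G u + dF G v).
  by rewrite -[LHS]/(L _) linearZ linearD.
rewrite -[RHS]/(dF G (2^-1 *: (left_gradient b F p + right_gradient b F p))) LE.
by rewrite addrC -b_bracket_left -b_bracket_right.
Qed.

Lemma sym_b_bracketC b F G : sym_b_bracket b F G = sym_b_bracket b G F.
Proof. exact: (congr1 ( *:%R 2^-1) (addrC _ _)). Qed.

Lemma sym_b_bracket_linear b F :
  linear (sym_b_bracket b F).
Proof.
move=> a G H; apply: Cinf_ext => p.
rewrite -[RHS]/(a * sym_b_bracket b F G p + sym_b_bracket b F H p).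
have E := sym_b_bracketE b F.
apply: (etrans (E _ p)); apply: (etrans (dF_linear_fun a G H _)).
exact: (esym (congr2 (fun x y => a * x + y) (E G p) (E H p))).
Qed.

Lemma sym_b_bracket_leibniz b F : leibniz_rule (sym_b_bracket b F).
Proof.
move=> G H; apply: Cinf_ext => p.
rewrite -[RHS]/(sym_b_bracket b F G p * H p + G p * sym_b_bracket b F H p).
have E := sym_b_bracketE b F.
apply: (etrans (E _ p)); apply: (etrans (dF_leibniz G H _)).
exact: (esym (congr2 (fun x y => x * H p + G p * y) (E G p) (E H p))).
Qed.

Lemma sym_b_bracket_symmetric_leibniz b :
  symmetric_leibniz_bracket (sym_b_bracket b).
Proof.
have sC G : (sym_b_bracket b)^~ G = sym_b_bracket b G.
  by apply/funext => F; exact: sym_b_bracketC.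
split; last exact: sym_b_bracketC.
split=> [|F|G]; last by rewrite sC; exact: sym_b_bracket_leibniz.
  split=> F; last exact: sym_b_bracket_linear.
  by rewrite sC; exact: sym_b_bracket_linear.
exact: sym_b_bracket_leibniz.
Qed.

End Gradient.

Theorem proposition3p14 (R : realType) (n : nat) (M : manifold R n)
    (b : geometric_structure M) :
  [/\ symmetric_leibniz_bracket (sym_b_bracket b),
      symmetric_leibniz_manifold (sym_b_bracket b) &
      forall F : Cinf M,
        let X : vector_field M :=
          2^-1 *: (left_gradient b F + right_gradient b F) in
        [/\ left_leibniz_vf (sym_b_bracket b) F
              = right_leibniz_vf (sym_b_bracket b) F,
            forall G : Cinf M,
              left_leibniz_vf (sym_b_bracket b) F G
              = derivation_of X G :> (M -> R^o) &
            forall G : Cinf M,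
              right_leibniz_vf (sym_b_bracket b) F G
              = derivation_of X G :> (M -> R^o)]].
Proof.
have symm := sym_b_bracket_symmetric_leibniz b.
split; [exact: symm|exact: symm|move=> F X].
have lrE : left_leibniz_vf (sym_b_bracket b) F =
    right_leibniz_vf (sym_b_bracket b) F.
  by apply/funext => G; exact: sym_b_bracketC.
have rE G :
    right_leibniz_vf (sym_b_bracket b) F G = derivation_of X G :> (M -> R^o).
  by apply/funext => p; exact: sym_b_bracketE.
by split; [exact: lrE|move=> G; rewrite lrE; exact: rE|exact: rE].
Qed.
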